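(* Let $\mathfrak{IV}$ be an integral vessel with $t_2$ ranging over $\mathbb R$, and let $I\Sigma$ be the associated system. Let $t_2^0\in\mathbb R$ be arbitrary. Then $I\Sigma$ is locally approximately controllable at $t_2^0$ if and only if $I\Sigma$ is approximately controllable at $t_2$ for all $t_2\in\mathbb R$.
   Context: Subscripts $*$ (as in $\sigma_{1*},\gamma_*,\mathcal E_*$) are part of the name and do not denote adjoints. ''Absolutely continuous'' and ''$L^1_{loc}$'' refer to the operator norm; absolutely continuous means on compact intervals. An (integral) vessel is a collection $$\mathfrak{IV}=(A_1(t_2),F(t_2,t_2^0),\widetilde B(t_2),C(t_2),D(t_2),\widetilde D(t_2);\sigma_1,\sigma_2,\gamma,\sigma_{1*},\sigma_{2*},\gamma_*;\mathcal H_{t_2},\mathcal E,\mathcal E_*,\widetilde{\mathcal E},\widetilde{\mathcal E}_* )$$ of Hilbert spaces and operator functions of $t_2$ with the following properties. (i) $F$ is an evolution semi-group: $F(t,s):\mathcal H_s\to\mathcal H_t$ is bounded and invertible, $F(r,s)F(s,t)=F(r,t)$, $F(t,t)=I$. (ii) $A_1(t_2):\mathcal H_{t_2}\to\mathcal H_{t_2}$, $\widetilde B(t_2):\widetilde{\mathcal E}\to\mathcal H_{t_2}$, $C(t_2):\mathcal H_{t_2}\to\mathcal E_*$ are bounded; for (almost) all $t$ the functions $s\mapsto F(t,s)\widetilde B(s)\sigma_1(s)$, $s\mapsto F(t,s)\widetilde B(s)\sigma_2(s)$, $s\mapsto C(s)F(s,t)$ are absolutely continuous. (iii) $D(t_2):\mathcal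 E\to\mathcal E_*$ and $\widetilde D(t_2):\widetilde{\mathcal E}\to\widetilde{\mathcal E}_*$ are absolutely continuous. (iv) $\sigma_2,\gamma\in L^1_{loc}$ with values in $\mathcal L(\mathcal E,\widetilde{\mathcal E})$; $\sigma_1(t_2)\in\mathcal L(\mathcal E,\widetilde{\mathcal E})$ is absolutely continuous with invertible values; likewise $\sigma_{2*},\gamma_*\in L^1_{loc}$ with values in $\mathcal L(\mathcal E_*,\widetilde{\mathcal E}_* )$ and $\sigma_{1*}(t_2)\in\mathcal L(\mathcal E_*,\widetilde{\mathcal E}_* )$ is absolutely continuous with invertible values. (v) The vessel conditions hold (those with derivatives for almost all $t_2$): $F(t_2,t_2^0)A_1(t_2^0)=A_1(t_2)F(t_2,t_2^0)$; $\frac{d}{dt_2}\big(F(t_2^0,t_2)\widetilde B\sigma_1\big)+F(t_2^0,t_2)A_1\widetilde B\sigma_2+F(t_2^0,t_2)\widetilde B\gamma=0$; $\sigma_{2*}CA_1F(t_2,t_2^0)-\sigma_{1*}\frac{d}{dt_2}[CF(t_2,t_2^0)]+\gamma_*CF(t_2,t_2^0)=0$; $\sigma_{1*}D=\widetilde D\sigma_1$, $\sigma_{2*}D=\widetilde D\sigma_2$, $\widetilde D\gamma=\sigma_{2*}C\widetilde B\sigma_1-\sigma_{1*}C\widetilde B\sigma_2-\sigma_{1*}\frac{dD}{dt_2}+\gamma_*D$. The associated system $I\Sigma$ is $\frac{\partial}{\partial t_1}x(t_1,t_2)=A_1(t_2)x(t_1,t_2)+\widetilde B(t_2)\sigma_1(t_2)u(t_1,t_2)$,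 $x(t_1,t_2)=F(t_2,t_2^0)x(t_1,t_2^0)+\int_{t_2^0}^{t_2}F(t_2,s)\widetilde B(s)\sigma_2(s)u(t_1,s)\,ds$, $y(t_1,t_2)=C(t_2)x(t_1,t_2)+D(t_2)u(t_1,t_2)$. The system is locally approximately controllable at $t_2$ if $$\mathcal C_{t_2}=\operatorname{span}\{\operatorname{Im}A_1^j(t_2)\widetilde B(t_2)\mid j=0,1,2,\dots\}$$ is dense in $\mathcal H_{t_2}$. It is approximately controllable at $t_2$ if $$\widetilde{\mathcal C}_{t_2}=\operatorname{span}\{\operatorname{Im}F(t_2,s)A_1^j(s)\widetilde B(s)\mid j=0,1,2,\dots,\ s\in\mathbb R\}$$ is dense in $\mathcal H_{t_2}$. *)

(* Defs.v *)
From HB Require Import structures.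
From mathcomp Require Import all_boot all_order all_algebra.
From mathcomp Require Import complex.
From mathcomp Require Import all_classical all_reals all_analysis.

Set Implicit Arguments.
Unset Strict Implicit.
Unset Printing Implicit Defensive.

Import Order.TTheory GRing.Theory Num.Theory.
Import numFieldNormedType.Exports.

Local Open Scope classical_set_scope.
Local Open Scope ring_scope.
Local Open Scope complex_scope.

(* The inner product is linear in the first argument and conjugate-linear in
   the second one. *)
HB.mixin Record CompleteNormedModule_isHilbert (C : numClosedFieldType) V
    of CompleteNormedModule C V := {
  hdot : {dot V for Num.conj} ;
  normr_hdot : forall x : V, `|x| ^+ 2 = hdot x x
}.

#[short(type="hilbertType")]
HB.structure Definition Hilbert (C : numClosedFieldType) :=
  {V of CompleteNormedModule C V & CompleteNormedModule_isHilbert C V}.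

Record bounded_op (C : numFieldType) (U V : normedModType C) := BoundedOp {
  bop_fun :> {linear U -> V} ;
  bop_bounded : exists M : C, forall x, `|bop_fun x| <= M * `|x|
}.

Notation "''L' ( U , V )" := (bounded_op U V)
  (at level 8, format "''L' ( U ,  V )") : type_scope.

Lemma bop_comp_bounded (C : numFieldType) (U V W : normedModType C)
    (g : 'L(V, W)) (f : 'L(U, V)) :
  exists M : C, forall x, `|(g \o f) x| <= M * `|x|.
Proof.
have [M gM] := bop_bounded g; have [N fN] := bop_bounded f.
exists (`|M| * N) => x /=.
have gM' y : `|g y| <= `|M| * `|y|.
  have [->|y0] := eqVneq y 0; first by rewrite linear0 !normr0 mulr0.
  have y_gt0 : 0 < `|y| by rewrite normr_gt0.
  have Mge0 : 0 <= M.
    by rewrite -(pmulr_lge0 _ y_gt0) (le_trans _ (gM y)).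
  by rewrite (ger0_norm Mge0).
by rewrite (le_trans (gM' _))// -mulrA ler_wpM2l.
Qed.

Definition bop_comp (C : numFieldType) (U V W : normedModType C)
    (g : 'L(V, W)) (f : 'L(U, V)) : 'L(U, W) :=
  @BoundedOp C U W (g \o f) (bop_comp_bounded g f).

Notation "g '\bo' f" := (bop_comp g f)
  (at level 50, left associativity, format "g  \bo  f").

Definition bop_invertible (C : numFieldType) (U V : normedModType C)
    (f : 'L(U, V)) :=
  exists g : 'L(V, U), cancel f g /\ cancel g f.

Section operator_valued_functions.
Context {R : realType}.
Variables U V : normedModType R[i].

(* Norms in a normed module over R[i] are elements of R[i] (with zero
   imaginary part), hence the real part. [sup] of an unbounded set is 0, so
   this is the operator norm only when f is a bounded linear map; it is used
   below only for linear combinations of elements of 'L(U, V). *)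
Definition opnorm (f : U -> V) : R :=
  sup [set complex.Re `|f x| | x in [set x | `|x| <= 1]].

Implicit Types (G : R -> 'L(U, V)) (a b t : R).

Definition op_abs_cont_on a b G :=
  forall e : R, 0 < e -> exists2 d : R, 0 < d &
    forall n (u v : 'I_n -> R),
      (forall i, a <= u i /\ u i <= v i /\ v i <= b) ->
      trivIset setT (fun i => `]u i, v i[%classic) ->
      \sum_(i < n) (v i - u i) < d ->
      \sum_(i < n) opnorm (fun x => G (v i) x - G (u i) x) < e.

Definition op_abs_cont G := forall a b, op_abs_cont_on a b G.

Definition op_is_derive G t (G' : 'L(U, V)) :=
  opnorm (fun x => (h^-1)%:C *: (G (t + h) x - G t x) - G' x)
    @[h --> (0 : R)^'] --> (0 : R).

Definition op_simple G :=
  finite_set (range G) /\ forall T, measurable (G @^-1` [set T]).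

(* Bochner measurability *)
Definition op_strongly_measurable G :=
  exists2 S : nat -> R -> 'L(U, V), forall n, op_simple (S n) &
    {ae lebesgue_measure, forall t,
      opnorm (fun x => S n t x - G t x) @[n --> \oo] --> (0 : R)}.

(* The integrand agrees only almost everywhere with a Borel function; the
   integral of a nonnegative function is defined by a supremum over simple
   functions below it, so it is still the Lebesgue integral. *)
Definition op_L1loc G :=
  op_strongly_measurable G /\
  forall a b, (\int[lebesgue_measure]_(t in `[a, b]) (opnorm (G t))%:E < +oo)%E.

End operator_valued_functions.

(* The suffix s stands for the subscript * and the suffix t for the tilde:
   sigma1s is sigma_{1*}, vDt is D tilde, vEts is E tilde *. *)
Record vessel (R : realType) := Vessel {
  vH : R -> hilbertType R[i] ;
  vE : hilbertType R[i] ;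
  vEs : hilbertType R[i] ;
  vEt : hilbertType R[i] ;
  vEts : hilbertType R[i] ;

  vA1 : forall t, 'L(vH t, vH t) ;
  vF : forall t s, 'L(vH s, vH t) ;
  vBt : forall t, 'L(vEt, vH t) ;
  vC : forall t, 'L(vH t, vEs) ;
  vD : R -> 'L(vE, vEs) ;
  vDt : R -> 'L(vEt, vEts) ;
  sigma1 : R -> 'L(vE, vEt) ;
  sigma2 : R -> 'L(vE, vEt) ;
  gamma : R -> 'L(vE, vEt) ;
  sigma1s : R -> 'L(vEs, vEts) ;
  sigma2s : R -> 'L(vEs, vEts) ;
  gammas : R -> 'L(vEs, vEts) ;

  F_invertible : forall t s, bop_invertible (vF t s) ;
  F_comp : forall r s t x, vF r s (vF s t x) = vF r t x ;
  F_id : forall t x, vF t t x = x ;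

  FBsigma1_ac : {ae lebesgue_measure, forall t,
    op_abs_cont (fun s => vF t s \bo vBt s \bo sigma1 s)} ;
  FBsigma2_ac : {ae lebesgue_measure, forall t,
    op_abs_cont (fun s => vF t s \bo vBt s \bo sigma2 s)} ;
  CF_ac : {ae lebesgue_measure, forall t,
    op_abs_cont (fun s => vC s \bo vF s t)} ;

  D_ac : op_abs_cont vD ;
  Dt_ac : op_abs_cont vDt ;

  sigma2_L1loc : op_L1loc sigma2 ;
  gamma_L1loc : op_L1loc gamma ;
  sigma1_ac : op_abs_cont sigma1 ;
  sigma1_invertible : forall t, bop_invertible (sigma1 t) ;
  sigma2s_L1loc : op_L1loc sigma2s ;
  gammas_L1loc : op_L1loc gammas ;
  sigma1s_ac : op_abs_cont sigma1s ;
  sigma1s_invertible : forall t, bop_invertible (sigma1s t) ;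

  lax : forall t t0 x, vF t t0 (vA1 t0 x) = vA1 t (vF t t0 x) ;
  input_condition : forall t0, {ae lebesgue_measure, forall t,
    exists2 G' : 'L(vE, vH t0),
      op_is_derive (fun s => vF t0 s \bo vBt s \bo sigma1 s) t G' &
      forall e, G' e + vF t0 t (vA1 t (vBt t (sigma2 t e)))
                + vF t0 t (vBt t (gamma t e)) = 0} ;
  output_condition : forall t0, {ae lebesgue_measure, forall t,
    exists2 G' : 'L(vH t0, vEs),
      op_is_derive (fun s => vC s \bo vF s t0) t G' &
      forall x, sigma2s t (vC t (vA1 t (vF t t0 x))) - sigma1s t (G' x)
                + gammas t (vC t (vF t t0 x)) = 0} ;
  linkage_sigma1 : forall t e, sigma1s t (vD t e) = vDt t (sigma1 t e) ;
  linkage_sigma2 : forall t e, sigma2s t (vD t e) = vDt t (sigma2 t e) ;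
  linkage_gamma : {ae lebesgue_measure, forall t,
    exists2 D' : 'L(vE, vEs), op_is_derive vD t D' &
      forall e, vDt t (gamma t e) =
        sigma2s t (vC t (vBt t (sigma1 t e)))
        - sigma1s t (vC t (vBt t (sigma2 t e)))
        - sigma1s t (D' e) + gammas t (vD t e)}
}.

Arguments vA1 {R} v t.
Arguments vF {R} v t s.
Arguments vBt {R} v t.
Arguments vC {R} v t.

Definition lin_span (K : pzRingType) (V : lmodType K) (S : set V) : set V :=
  [set x | exists n (a : 'I_n -> K) (v : 'I_n -> V),
    (forall i, S (v i)) /\ x = \sum_(i < n) a i *: v i].

Section controllability.
Context {R : realType}.
Variable V : vessel R.

Definition local_controllable_space (t : R) : set (vH V t) :=
  lin_span (\bigcup_j range (fun e => iter j (vA1 V t) (vBt V t e))).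
Arguments local_controllable_space : clear implicits.

Definition controllable_space (t : R) : set (vH V t) :=
  lin_span (\bigcup_s \bigcup_j
    range (fun e => vF V t s (iter j (vA1 V s) (vBt V s e)))).
Arguments controllable_space : clear implicits.

(* Both notions for the system associated with the vessel involve only the
   operators A_1, F and B tilde, not the trajectories of the system. *)
Definition locally_approximately_controllable (t : R) :=
  dense (local_controllable_space t).

Definition approximately_controllable (t : R) :=
  dense (controllable_space t).

End controllability.

Arguments local_controllable_space {R} V t _.
Arguments controllable_space {R} V t _.

(* Main.v *)
Require Import Defs.
From mathcomp Require Import all_boot all_order all_algebra.
From mathcomp Require Import complex ring lra.
From mathcomp Require Import all_classical all_reals all_analysis.
From mathcomp Require Import measurable_realfun.

(** Write [X s = F(t0, s) B(s) sigma1(s)]. The Lax equation moves the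
    generators of the controllable space at [t0] to [A1(t0)^j F(t0, s) B(s) e],
    so that space is spanned by the vectors [A1(t0)^j X(s) e], whereas the
    local space is spanned by those with [s = t0]. The content of the theorem is
    that varying [s] gives nothing new up to closure.

    The input vessel condition says that for almost all [s]
<<
      X' = - A1(t0) X sigma1^-1 sigma2 - X sigma1^-1 gamma.
>>
    Let [p] be the distance to the local space at [t0]. This space is invariant
    under [A1(t0)], so [p (A1(t0) x)] is at most a constant times [p x]: the
    equation descends to the quotient by the closure of the local space. There
    it is a linear homogeneous equation with locally integrable coefficients
    (the inverses of [sigma1] are locally bounded and [sigma2], [gamma] are
    locally integrable), and its solution vanishes at [s = t0]. Gronwall's
    argument ([gronwall_local], [gronwall_global]) shows that it vanishes
    everywhere, that is, the controllable space at [t0] lies in the closure of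
    the local one ([controllable_space_dist0]). Hence controllability at [t0]
    implies local controllability at [t0]. In the other direction, [F(t, t0)] is
    an isomorphism which maps the local space at [t0] into the controllable
    space at [t].

    Since the equation holds only almost everywhere and [X] is absolutely
    continuous with values in operators, Gronwall's argument rests on a mean
    value inequality for absolutely continuous increments
    ([abs_cont_increment_le]). It compares the seminorms of the increments of
    [X] with the increments of a primitive of the integrable coefficient, whose
    derivative is known almost everywhere by Lebesgue's differentiation theorem
    ([primitive_ae_derivative]). *)

Set Implicit Arguments.
Unset Strict Implicit.
Unset Printing Implicit Defensive.

Import Order.TTheory GRing.Theory Num.Theory.
Import numFieldNormedType.Exports.

Local Open Scope classical_set_scope.
Local Open Scope ring_scope.

(** * Real-valued norms and operator seminorms *)

Section real_norm.
Context {R : realType}.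

(** Norms in a normed module over [R[i]] are elements of [R[i]]; every estimate
    below takes place in [R]. *)
Definition rnorm (V : normedModType R[i]) (x : V) : R := complex.Re `|x|.

Lemma normr_rnorm (V : normedModType R[i]) (x : V) : `|x| = (rnorm x)%:C%C.
Proof.
rewrite /rnorm; have := normr_ge0 x; case: `|x| => a b /=.
by rewrite lecE /= => /andP[/eqP -> _].
Qed.

Context {V : normedModType R[i]}.
Implicit Types x y : V.

Lemma rnorm_ge0 x : 0 <= rnorm x.
Proof. by rewrite -lecR -normr_rnorm normr_ge0. Qed.

Lemma rnorm0 : rnorm (0 : V) = 0.
Proof. by rewrite /rnorm normr0. Qed.

Lemma ler_rnormD x y : rnorm (x + y) <= rnorm x + rnorm y.
Proof. by rewrite -lecR rmorphD /= -!normr_rnorm ler_normD. Qed.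

Lemma rnormZ (a : R[i]) x : rnorm (a *: x) = rnorm (a : R[i]^o) * rnorm x.
Proof.
apply: (@complexI R); rewrite rmorphM /= -!normr_rnorm.
exact: normrZ.
Qed.

Lemma rnormZr (a : R) x : rnorm (a%:C%C *: x) = `|a| * rnorm x.
Proof.
rewrite rnormZ; congr (_ * _); rewrite /rnorm.
by rewrite [`|_|]normc_def /= expr0n /= addr0 sqrtr_sqr.
Qed.

Lemma rnormN x : rnorm (- x) = rnorm x.
Proof. by rewrite /rnorm normrN. Qed.

End real_norm.

(** A complex constant bounding an operator need not be real when the domain
    is trivial, hence its modulus. *)
Lemma bop_rbounded (R : realType) (U V : normedModType R[i]) (f : 'L(U, V)) :
  exists2 m : R, 0 <= m & forall x, rnorm (f x) <= m * rnorm x.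
Proof.
have [M fM] := bop_bounded f.
exists (rnorm (M : R[i]^o)); first exact: rnorm_ge0.
move=> x; rewrite -lecR rmorphM /= -!normr_rnorm.
have [->|x0] := eqVneq x 0; first by rewrite linear0 !normr0 mulr0.
have x_gt0 : 0 < `|x| by rewrite normr_gt0.
rewrite (le_trans (fM x)) // ler_wpM2r //.
by rewrite real_ler_norm // ger0_real // -(pmulr_lge0 _ x_gt0) (le_trans _ (fM x)).
Qed.

Section seminorm_bound.
Context {R : realType} {U V : normedModType R[i]}.

(** The seminorm of interest is the distance to a subspace, which is the norm
    of the quotient by the closure of that subspace. Working with a seminorm
    on [V] avoids forming the quotient. *)
Record rseminorm := RSeminorm {
  rsn_fun :> V -> R ;
  rsn_ge0 : forall x, 0 <= rsn_fun x ;
  rsn_le : forall x, rsn_fun x <= rnorm x ;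
  rsnD : forall x y, rsn_fun (x + y) <= rsn_fun x + rsn_fun y ;
  rsnZ : forall (a : R[i]) x, rsn_fun (a *: x) <= rnorm (a : R[i]^o) * rsn_fun x }.

Definition norm_seminorm : rseminorm.
Proof.
exists (@rnorm R V) => //; first exact: rnorm_ge0.
- exact: ler_rnormD.
- by move=> a x; rewrite rnormZ.
Defined.

(** With [p] the norm this unfolds to [opnorm]; with [p] the distance to a
    subspace it is the operator norm of [f] followed by the quotient map. *)
Definition opseminorm (p : rseminorm) (f : U -> V) : R :=
  sup [set p (f x) | x in [set x : U | `|x| <= 1]].

(** [f] is a bare function because [opnorm] is applied to pointwise differences
    of operators. Boundedness makes the set under the supremum bounded, without
    which the supremum would be the default value 0. *)
Lemma le_opseminorm (p : rseminorm) (f : U -> V) (m : R) :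
  (forall (a : R[i]) x, f (a *: x) = a *: f x) ->
  (forall x, rnorm (f x) <= m * rnorm x) ->
  forall x, p (f x) <= opseminorm p f * rnorm x.
Proof.
move=> fZ fm x.
have [x0|x0] := eqVneq (rnorm x) 0.
  rewrite x0 mulr0 (le_trans (rsn_le _ _))// (le_trans (fm _))//.
  by rewrite x0 mulr0.
have x_gt0 : 0 < rnorm x by rewrite lt_def x0 rnorm_ge0.
have ub y : rnorm y <= 1 -> p (f y) <= `|m|.
  move=> y1; rewrite (le_trans (rsn_le _ _))// (le_trans (fm _))//.
  rewrite (le_trans (ler_norm _))// normrM (ger0_norm (rnorm_ge0 _)).
  by rewrite ler_piMr.
pose y := (rnorm x)^-1%:C%C *: x.
have y1 : rnorm y = 1.
  by rewrite rnormZr ger0_norm ?invr_ge0 ?rnorm_ge0// mulVf.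
have pfy : p (f y) <= opseminorm p f.
  apply: ub_le_sup.
    exists `|m| => _ [z /= z1 <-]; apply: ub.
    by rewrite -lecR -normr_rnorm.
  by exists y => //=; rewrite normr_rnorm y1.
have -> : f x = (rnorm x)%:C%C *: f y.
  by rewrite -fZ scalerA -rmorphM /= mulfV// scale1r.
rewrite (le_trans (rsnZ _ _ _))// mulrC ler_pM//.
- exact: rsn_ge0.
- exact: rnorm_ge0.
- have := rnormZr (rnorm x) (1 : R[i]^o); rewrite scaler1 => ->.
  by rewrite {2}/rnorm normr1 mulr1 ger0_norm// rnorm_ge0.
Qed.

Lemma opseminorm_le (p : rseminorm) (f : U -> V) (m : R) : 0 <= m ->
  (forall x, p (f x) <= m * rnorm x) -> opseminorm p f <= m.
Proof.
move=> m0 fm; apply: ge_sup.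
  by exists (p (f 0)), 0 => //=; rewrite normr0.
move=> _ [x /= x1 <-]; rewrite (le_trans (fm _))// ler_piMr//.
by rewrite -lecR -normr_rnorm.
Qed.

Lemma opseminorm_ge0 (p : rseminorm) (f : U -> V) : 0 <= opseminorm p f.
Proof.
set S := [set p (f x) | x in [set x | `|x| <= 1]].
have S0 : S (p (f 0)) by exists 0 => //=; rewrite normr0.
have [supS|/sup_out supS] := pselect (has_sup S).
  by rewrite (le_trans (rsn_ge0 p (f 0)))// ub_le_sup//; exact: supS.2.
by rewrite [opseminorm p f]supS.
Qed.

End seminorm_bound.

(** * A mean value inequality for absolutely continuous increments *)

Section real_analysis.
Context {R : realType}.
Implicit Types (a b t u v : R).

(** Cousin's lemma: every tag [t] comes with a scale below which all intervals
    straddling [t] are good, and good intervals can be glued. The supremum of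
    the points reachable from [a] can be straddled, hence passed unless it
    is [b]. *)
Lemma cousin_straddle a b (Rel : R -> R -> Prop) : a <= b ->
  (forall u v w, Rel u v -> Rel v w -> Rel u w) ->
  (forall t, a <= t <= b -> exists2 d : R, 0 < d &
    forall u v, a <= u -> t - d < u -> u <= t -> t <= v -> v < t + d -> v <= b ->
      Rel u v) ->
  Rel a b.
Proof.
move=> ab tr loc.
pose S := [set t | a <= t <= b /\ Rel a t].
have Sa : S a.
  split; first by rewrite lexx.
  have [|d d0] := loc a; first by rewrite lexx ab.
  by apply; rewrite ?lexx// ?ltrBlDr ?ltrDl.
have supS : has_sup S.
  by split; [exists a|exists b => t [/andP[]]].
have ac : a <= sup S by apply: ub_le_sup => //; exact: supS.2.
have cb : sup S <= b by apply: ge_sup; [exists a|move=> t [/andP[]]].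
have [|d d0 locd] := loc (sup S); first by rewrite ac cb.
have [t [/andP[a_t tb] Rat] ct] := sup_adherent d0 supS.
have tc : t <= sup S.
  by apply: ub_le_sup; [exact: supS.2|split => //; rewrite a_t tb].
have Rac v : sup S <= v -> v < sup S + d -> v <= b -> Rel a v.
  by move=> cv vd vb; apply: tr Rat _; apply: locd.
have [eb|neb] := eqVneq (sup S) b.
  by rewrite -{1}eb in Rac *; apply: Rac; rewrite ?lexx ?eb// ltrDl.
have ltb : sup S < b by rewrite lt_neqAle neb.
pose v := Num.min b (sup S + d / 2).
have cv : sup S < v by rewrite lt_min ltb ltrDl divr_gt0.
have vb : v <= b by rewrite ge_min lexx.
have vd : v < sup S + d.
  by rewrite gt_min ltrD2l ltr_pdivrMr// ltr_pMr// ltr1n orbT.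
have Sv : S v.
  split; first by rewrite vb andbT (le_trans ac (ltW cv)).
  by apply: Rac => //; exact: ltW.
have := ub_le_sup supS.2 Sv.
by rewrite leNgt cv.
Qed.

Lemma sum_length_le (O : set R) (e : R) n (u v : 'I_n -> R) :
  open O -> (lebesgue_measure O < e%:E)%E ->
  (forall i, u i <= v i) ->
  (forall i, `]u i, v i[%classic `<=` O) ->
  trivIset setT (fun i => `]u i, v i[%classic) ->
  \sum_(i < n) (v i - u i) < e.
Proof.
move=> oO Oe uv uvO triv; rewrite -lte_fin; apply: le_lt_trans Oe.
have -> : ((\sum_(i < n) (v i - u i))%:E =
   lebesgue_measure (\big[setU/set0]_(i < n) `]u i, v i[%classic))%E.
  rewrite measure_bigsetU_ord//= -sumEFin; apply: eq_bigr => i _.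
  rewrite lebesgue_measure_itv/= lte_fin.
  case: ltP => // vu.
  have -> : v i = u i by apply/eqP; rewrite eq_le uv vu.
  by rewrite subrr.
apply: le_measure; rewrite ?inE.
- by apply: bigsetU_measurable => i _.
- exact: open_measurable.
- by rewrite -bigcup_seq => x [i _]; exact: uvO.
Qed.

(** [D u v] stands for the size of the increment over [[u, v]] of a function
    with values in an arbitrary space. *)
Definition abs_cont_increments a b (D : R -> R -> R) :=
  forall e : R, 0 < e -> exists2 d : R, 0 < d &
    forall n (u v : 'I_n -> R),
      (forall i, a <= u i /\ u i <= v i /\ v i <= b) ->
      trivIset setT (fun i => `]u i, v i[%classic) ->
      \sum_(i < n) (v i - u i) < d ->
      \sum_(i < n) D (u i) (v i) < e.

(** A mean value inequality with an exceptional null set [Z]. Cover [Z] by an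
    open set [O] of small measure and apply Cousin's lemma: intervals tagged
    outside [Z] are controlled by the local bound, and those tagged in [Z] lie
    in [O], so that their total length is small and absolute continuity makes
    their total increment small. *)
Lemma abs_cont_increment_le a b (D : R -> R -> R) (g : R -> R) (Z : set R) :
  a <= b ->
  (forall u v w, u <= v -> v <= w -> D u w <= D u v + D v w) ->
  abs_cont_increments a b D ->
  (forall u v, a <= u -> u <= v -> v <= b -> g u <= g v) ->
  lebesgue_measure.-negligible Z ->
  (forall t, a <= t <= b -> ~ Z t -> forall e, 0 < e -> exists2 d : R, 0 < d &
    forall u v, a <= u -> t - d < u -> u <= t -> t <= v -> v < t + d -> v <= b ->
      D u v <= g v - g u + e * (v - u)) ->
  D a b <= g b - g a.
Proof.
move=> ab DD Dac gmono [Z' [mZ' Z'0 ZZ']] Dloc.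
suff H e : 0 < e -> D a b <= g b - g a + e * (b - a) + e.
  apply/ler_addgt0Pl => e e0.
  have ba : 0 < b - a + 1 by rewrite ltr_wpDl// subr_ge0.
  have := H (e / (b - a + 1)) (divr_gt0 e0 ba).
  by rewrite -addrA -[X in _ * _ + X]mulr1 -mulrDr -mulrA mulVf ?mulr1 ?gt_eqF// addrC.
move=> e0; have [d d0 Dd] := Dac e e0.
have [|O [oO Z'O Od]] := lebesgue_regularity_outer mZ' _ d0.
  by rewrite [X in (X < _)%E]Z'0.
have {}Od : (lebesgue_measure O < d%:E)%E.
  have mO : measurable O by exact: open_measurable.
  rewrite (@measureDI _ _ _ lebesgue_measure O Z')//.
  rewrite [X in (_ + X)%E](_ : _ = 0%E) ?adde0//.
  by apply: (subset_measure0 _ _ _ Z'0) => //; exact: measurableI.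
(* The intervals ]p i, q i[ are those tagged in Z; the intervals tagged
   elsewhere are already absorbed in g v - g u + e * (v - u). *)
pose Rel u v := exists n (p q : 'I_n -> R),
  [/\ u <= v, (forall i, u <= p i /\ p i <= q i /\ q i <= v),
    trivIset setT (fun i => `]p i, q i[%classic),
    (forall i, `]p i, q i[%classic `<=` O) &
    D u v <= g v - g u + e * (v - u) + \sum_(i < n) D (p i) (q i)].
suff [n [p [q [_ pq triv pqO Dab]]]] : Rel a b.
  apply: (le_trans Dab); rewrite lerD2l ltW//; apply: Dd => //.
  by apply: (sum_length_le oO Od) => // i; have [_ []] := pq i.
apply: cousin_straddle ab _ _ => [u v w|t tab].
  move=> [n [p [q [uv pq triv pqO Duv]]]] [m [p' [q' [vw pq' triv' pqO' Dvw]]]].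
  exists (n + m)%N,
    (fun i : 'I_(n + m) =>
      match fintype.split i with inl i => p i | inr i => p' i end),
    (fun i : 'I_(n + m) =>
      match fintype.split i with inl i => q i | inr i => q' i end); split.
  - exact: le_trans uv vw.
  - move=> i; case: fintype.split => j.
      by have [up [pjq qv]] := pq j; do !split => //; exact: le_trans qv vw.
    by have [vp [pjq qv]] := pq' j; do !split => //; exact: le_trans uv vp.
  - move=> i j _ _ /=.
    move=> [x xij]; apply: (can_inj (@splitK n m)); move: xij.
    case: (fintype.split i) => k; case: (fintype.split j) => l [] /=; rewrite !in_itv /=.
    + move=> xk xl; congr inl; apply: triv => //.
      by exists x; split; rewrite /= in_itv.
    + move=> /andP[_ xq] /andP[px _]; have [_ [_ qv]] := pq k; have [vp _] := pq' l.
      by have := lt_trans px xq; rewrite ltNge (le_trans qv).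
    + move=> /andP[px _] /andP[_ xq]; have [_ [_ qv]] := pq l; have [vp _] := pq' k.
      by have := lt_trans px xq; rewrite ltNge (le_trans qv).
    + move=> xk xl; congr inr; apply: triv' => //.
      by exists x; split; rewrite /= in_itv.
  - by move=> i; case: fintype.split => j.
  - rewrite (le_trans (DD u v w uv vw))// (le_trans (lerD Duv Dvw))//.
    rewrite big_split_ord/=.
    under [X in _ <= _ + (X + _)]eq_bigr do rewrite (unsplitK (inl _)).
    under [X in _ <= _ + (_ + X)]eq_bigr do rewrite (unsplitK (inr _)).
    lra.
have [Zt|nZt] := pselect (Z t).
  have Ot : O t by apply/Z'O/ZZ'.
  have /nbhs_ballP[r /= r0 rO] := open_nbhs_nbhs (conj oO Ot).
  exists r => // u v au tru ut tv vtr vb.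
  have uv := le_trans ut tv.
  exists 1%N, (fun=> u), (fun=> v); split=> //.
  - by move=> i j _ _ _; rewrite !ord1.
  - move=> _ x /=; rewrite in_itv/= => /andP[ux xv]; apply: rO.
    by rewrite /ball/= ltr_norml; lra.
  - rewrite big_ord1 lerDr addr_ge0//; first by rewrite subr_ge0 gmono.
    by rewrite mulr_ge0 ?subr_ge0// ltW.
have [r r0 Dr] := Dloc t tab nZt e e0.
exists r => // u v au tru ut tv vtr vb.
exists 0%N, (fun=> u), (fun=> v); split=> //.
- exact: le_trans ut tv.
- by case.
- by case.
- by case.
- by rewrite big_ord0 addr0; exact: Dr.
Qed.

End real_analysis.

(** * Operator-valued functions and their norms *)

Section bop_bounds.
Context {R : realType} {U V : normedModType R[i]}.
Implicit Types (p : @rseminorm R V) (f g : 'L(U, V)) (G : R -> 'L(U, V)).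

Lemma le_opseminorm_bop p f x : p (f x) <= opseminorm p f * rnorm x.
Proof.
have [m _ fm] := bop_rbounded f.
by apply: le_opseminorm fm _ => a y; rewrite linearZ.
Qed.

Lemma le_opseminorm_diff p f g x :
  p (f x - g x) <= opseminorm p (fun x => f x - g x) * rnorm x.
Proof.
have [m _ fm] := bop_rbounded f; have [n _ gn] := bop_rbounded g.
apply: (@le_opseminorm R U V p (fun x => f x - g x) (m + n)) => [a y|y].
  by rewrite scalerBr; congr (_ - _); exact: linearZZ.
by rewrite (le_trans (ler_rnormD _ _))// rnormN mulrDl lerD.
Qed.

Lemma rnorm_opnorm f x : rnorm (f x) <= opnorm f * rnorm x.
Proof. exact: (le_opseminorm_bop (@norm_seminorm R V)). Qed.

Lemma rnorm_opnorm_diff f g x :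
  rnorm (f x - g x) <= opnorm (fun x => f x - g x) * rnorm x.
Proof. exact: (le_opseminorm_diff (@norm_seminorm R V)). Qed.

Lemma opnorm_ge0 (f : U -> V) : 0 <= opnorm f.
Proof. exact: (opseminorm_ge0 (@norm_seminorm R V)). Qed.

Lemma opnorm_le (f : U -> V) (m : R) : 0 <= m ->
  (forall x, rnorm (f x) <= m * rnorm x) -> opnorm f <= m.
Proof. exact: (opseminorm_le (p := @norm_seminorm R V)). Qed.

Lemma opseminorm_diff_le_opnorm p f g :
  opseminorm p (fun x => f x - g x) <= opnorm (fun x => f x - g x).
Proof.
apply: opseminorm_le => [|x]; first exact: opnorm_ge0.
by rewrite (le_trans (rsn_le _ _))// rnorm_opnorm_diff.
Qed.

Lemma opnorm_diffC f g :
  opnorm (fun x => f x - g x) = opnorm (fun x => g x - f x).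
Proof.
rewrite /opnorm; congr sup; apply/seteqP; split=> _ [x x1 <-]; exists x => //;
  by rewrite distrC.
Qed.

(** This makes the norms of the simple functions approximating a Bochner
    measurable function converge. *)
Lemma ler_opnorm_dist f g :
  `|opnorm f - opnorm g| <= opnorm (fun x => f x - g x).
Proof.
have H (f' g' : 'L(U, V)) :
    opnorm f' <= opnorm g' + opnorm (fun x => f' x - g' x).
  apply: opnorm_le => [|x]; first by rewrite addr_ge0 ?opnorm_ge0.
  rewrite -[f' x](subrK (g' x)) addrC (le_trans (ler_rnormD _ _))//.
  rewrite mulrDl lerD// ?rnorm_opnorm//.
  by rewrite [X in X <= _](_ : _ = rnorm (f' x - g' x)) ?rnorm_opnorm_diff.
rewrite ler_distl lerBlDr H andbT.
by rewrite opnorm_diffC H.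
Qed.

Lemma op_abs_cont_near G t e : op_abs_cont G -> 0 < e ->
  exists2 d : R, 0 < d &
    forall s, `|s - t| < d -> opnorm (fun x => G s x - G t x) < e.
Proof.
move=> Gac e0; have [d d0 Gd] := Gac (t - 1) (t + 1) e e0.
exists (Num.min d 1) => [|s]; first by rewrite lt_min d0/=.
rewrite lt_min => /andP[sd s1].
have key u v : t - 1 <= u -> u <= v -> v <= t + 1 -> v - u < d ->
    opnorm (fun x => G v x - G u x) < e.
  move=> tu uv vt vud.
  have := Gd 1%N (fun=> u) (fun=> v); rewrite !big_ord1; apply => //.
  by move=> i j _ _ _; rewrite !ord1.
move: sd s1; rewrite !ltr_norml => /andP[sd1 sd2] /andP[s1 s2].
have [st|ts] := leP s t.
  by rewrite opnorm_diffC; apply: key => //; lra.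
by apply: key => //; lra.
Qed.

End bop_bounds.

Section L1loc.
Context {R : realType} {U V : normedModType R[i]}.
Local Notation mu := (@lebesgue_measure R).

Lemma op_simple_opnorm_measurable (S : R -> 'L(U, V)) :
  op_simple S -> measurable_fun setT (fun t => opnorm (S t)).
Proof.
move=> [finS mS] _ Y mY; rewrite setTI.
rewrite (_ : _ @^-1` _ =
  \bigcup_(T in range S `&` [set T : 'L(U, V) | Y (opnorm T)]) (S @^-1` [set T])).
  apply: fin_bigcup_measurable => //.
  exact: sub_finite_set finS.
apply/seteqP; split=> [t /= Yt|t [T [_ YT] /= ->]//].
by exists (S t) => //; split=> //; exists t.
Qed.

(** The norm of a function in [op_L1loc] is only almost everywhere equal to a
    Borel function. Setting it to 0 on a measurable null set outside which the
    simple approximations converge gives a Borel function, which lies below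
    the norm everywhere; the last fact bounds its integral, since the integral
    of a nonnegative function is monotone even at non-measurable functions. *)
Lemma L1loc_opnorm_version (G : R -> 'L(U, V)) : op_L1loc G ->
  exists k : R -> R, [/\ (forall t, 0 <= k t),
    (forall a b, mu.-integrable `[a, b] (EFin \o k)) &
    {ae mu, forall t, k t = opnorm (G t)}].
Proof.
move=> [[S sS [Z [mZ Z0 ZS]]] Gint].
have cvS t : ~ Z t -> opnorm (fun x => S n t x - G t x) @[n --> \oo] --> (0 : R).
  by move=> nZt; apply: contrapT => H; exact/nZt/ZS.
pose k t : R := \1_(~` Z) t * opnorm (G t).
have k0 t : 0 <= k t by rewrite mulr_ge0// opnorm_ge0.
have mk : measurable_fun setT k.
  apply: (@measurable_fun_cvg _ _ R setT
      (fun n t => \1_(~` Z) t * opnorm (S n t)) k) => [n|t _].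
    apply: measurable_funM; first exact/measurable_indic/measurableC.
    exact: op_simple_opnorm_measurable (sS n).
  rewrite /k indicE; have [tZ|] := boolP (t \in ~` Z); last first.
    by move=> _; under eq_fun do rewrite mul0r; rewrite mul0r; exact: cvg_cst.
  under eq_fun do rewrite mul1r; rewrite mul1r.
  apply/subr_cvg0/norm_cvg0P; apply: (squeeze_cvgr _ (cvg_cst 0) (cvS t _)).
    apply: nearW => n; rewrite normr_ge0/= ; exact: ler_opnorm_dist.
  by move: tZ; rewrite inE.
exists k; split => //.
- move=> a b; apply/integrableP; split.
    by apply/measurable_EFinP; exact: measurable_funTS.
  apply: le_lt_trans (Gint a b).
  rewrite !ge0_integralE//; last by move=> x _; rewrite lee_fin opnorm_ge0.
  apply: le_ereal_sup => _ [h /= hk <-]; exists h => //= t.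
  apply: (le_trans (hk t)); rewrite !patchE; case: ifP => // _.
  rewrite /= lee_fin ger0_norm// /k indicE.
  by case: (t \in _); rewrite ?mul1r ?mul0r ?opnorm_ge0.
- exists Z; split => // t /= kt; apply: contrapT => nZt; apply: kt.
  by rewrite /k indicE mem_set// mul1r.
Qed.

(** Lebesgue's differentiation theorem, with the derivative in straddled form:
    the increment is taken over an interval around [t] rather than from
    [t], as Cousin's lemma requires. *)
Lemma primitive_ae_derivative (k : R -> R) (a b : R) : a < b ->
  (forall t, 0 <= k t) -> mu.-integrable `[a, b] (EFin \o k) ->
  exists g : R -> R, [/\
    (forall u v, a <= u -> u <= v -> v <= b -> g u <= g v),
    {in `]a, b[, continuous g} &
    {ae mu, forall t, a < t < b -> forall e, 0 < e -> exists2 d : R, 0 < d &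
      forall u v, t - d < u -> u <= t -> t <= v -> v < t + d ->
        (k t - e) * (v - u) <= g v - g u}].
Proof.
move=> ab k0 ik; pose f := k \_ `[a, b].
have f0 t : 0 <= f t by rewrite /f patchE; case: ifP.
have iT : mu.-integrable setT (EFin \o f).
  by move: ik; rewrite integrable_mkcond//= restrict_EFin.
have iD (D : set R) : measurable D -> mu.-integrable D (EFin \o f).
  by move=> mD; apply: integrableS iT.
have locf : locally_integrable setT f by exact: open_integrable_locally openT iT.
pose g x := (\int[mu]_(t in [set` Interval (BLeft a) (BRight x)]) (f t))%R.
exists g; split.
- move=> u v au uv vb; rewrite -subr_ge0 Rintegral_itvB ?bnd_simp//; last exact: iD.
  by apply: Rintegral_ge0.
- have /continuous_within_itvP[//|H _ _] :=
    parameterized_integral_continuous (ltW ab) (iD _ (measurable_itv `[a, b])).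
  exact: H.
have ae := @FTC1 R f (BLeft a) (fun y => iD _ (measurable_itv _)) locf.
apply: (@filterS _ _ (ae_filter_ringOfSetsType mu) _ _ _ ae) => t Ht /andP[at_ tb] e e0.
have [|dg gE] := Ht; first by rewrite lte_fin.
have fk : f t = k t by rewrite /f patchE mem_set//= in_itv/= !ltW.
have {}dg : h^-1 *: (g (h *: 1 + t) - g t) @[h --> 0^'] --> k t.
  by rewrite -fk -gE derive1E; exact: dg.
move/cvgrPdist_lt/(_ e e0): dg => /nbhs_ballP[d /= d0 dP].
exists d => // u v tu ut tv vt.
have kg h : h != 0 -> `|h| < d -> `|k t - h^-1 * (g (h + t) - g t)| < e.
  move=> h0 hd; have := dP h; rewrite /ball/= sub0r normrN => /(_ hd h0).
  by rewrite [h *: 1]mulr1.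
have right : (k t - e) * (v - t) <= g v - g t.
  have [<-|vt0] := eqVneq t v; first by rewrite !subrr mulr0.
  have h0 : 0 < v - t by rewrite subr_gt0 lt_neqAle vt0.
  have := kg (v - t) (lt0r_neq0 h0); rewrite gtr0_norm// ltrBlDl => /(_ vt).
  rewrite subrK ltr_norml => /andP[_ H].
  by rewrite -ler_pdivlMr// ltW// mulrC; lra.
have left : (k t - e) * (t - u) <= g t - g u.
  have [<-|ut0] := eqVneq u t; first by rewrite !subrr mulr0.
  have h0 : 0 < t - u by rewrite subr_gt0 lt_neqAle ut0.
  have := kg (u - t); rewrite -oppr_eq0 opprB lt0r_neq0// -normrN opprB gtr0_norm//.
  rewrite subrK ltrBlDl -ltrBlDr => /(_ isT tu).
  have -> : (u - t)^-1 * (g u - g t) = (t - u)^-1 * (g t - g u).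
    by rewrite -(opprB t u) -(opprB (g t)) invrN mulrNN.
  rewrite ltr_norml => /andP[_ H].
  by rewrite -ler_pdivlMr// ltW// mulrC; lra.
have -> : (k t - e) * (v - u) = (k t - e) * (v - t) + (k t - e) * (t - u).
  by rewrite -mulrDr addrA subrK.
lra.
Qed.
End L1loc.

(** * Increments of operator-valued functions in a seminorm *)

Section seminorm_increments.
Context {R : realType} {U V : normedModType R[i]}.
Implicit Types (p : @rseminorm R V) (f g h : 'L(U, V)) (G : R -> 'L(U, V)).

Lemma rsnZr p (a : R) (x : V) : p (a%:C%C *: x) <= `|a| * p x.
Proof.
rewrite (le_trans (rsnZ _ _ _))// ler_wpM2r ?rsn_ge0//.
have := rnormZr a (1 : R[i]^o); rewrite /= scaler1 => ->.
by rewrite /rnorm normr1 mulr1.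
Qed.

Lemma rsnN p (x : V) : p (- x) = p x.
Proof.
suff H y : p (- y) <= p y by apply/eqP; rewrite eq_le H -{1}[x]opprK H.
rewrite -scaleN1r (le_trans (rsnZ _ _ _))//.
by rewrite /rnorm normrN normr1 mul1r.
Qed.

Lemma opseminorm_diff_triangle p f g h :
  opseminorm p (fun x => h x - f x) <=
  opseminorm p (fun x => g x - f x) + opseminorm p (fun x => h x - g x).
Proof.
apply: opseminorm_le => [|x]; first by rewrite addr_ge0 ?opseminorm_ge0.
have -> : h x - f x = (g x - f x) + (h x - g x) by rewrite [RHS]addrC addrA subrK.
by rewrite (le_trans (rsnD _ _ _))// mulrDl lerD ?le_opseminorm_diff.
Qed.

Lemma opseminorm_le_diff p f g : (forall x, p (g x) = 0) ->
  opseminorm p f <= opseminorm p (fun x => f x - g x).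
Proof.
move=> g0; apply: opseminorm_le => [|x]; first exact: opseminorm_ge0.
rewrite -{1}[f x](subrK (g x)) (le_trans (rsnD _ _ _))// g0 addr0.
exact: le_opseminorm_diff.
Qed.

(** Splitting an interval at the interior point [t] turns the two one-sided
    difference quotients into a bound on the whole increment. *)
Lemma op_is_derive_straddle p G t (G' : 'L(U, V)) : op_is_derive G t G' ->
  forall e, 0 < e -> exists2 d : R, 0 < d & forall u v,
    t - d < u -> u <= t -> t <= v -> v < t + d ->
    opseminorm p (fun x => G v x - G u x) <= (opseminorm p G' + e) * (v - u).
Proof.
move=> /cvgrPdist_lt dG e e0; have /nbhs_ballP[d /= d0 dP] := dG e e0.
have key (h : R) : `|h| < d ->
    opseminorm p (fun x => G (t + h) x - G t x) <=
    (opseminorm p G' + e) * `|h|.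
  move=> hd.
  have Ge0 : 0 <= opseminorm p G' + e by rewrite addr_ge0 ?opseminorm_ge0// ltW.
  have [->|h0] := eqVneq h 0.
    apply: opseminorm_le => [|x]; first by rewrite mulr_ge0.
    rewrite addr0 subrr normr0 mulr0 mul0r.
    by rewrite -(rnorm0 (V := V)) rsn_le.
  have {dP} := dP h; rewrite /ball/= !sub0r !normrN => /(_ hd h0).
  set Q := fun x => _ - G' x; move=> Qe.
  have QE x : G (t + h) x - G t x = h%:C%C *: (Q x + G' x).
    by rewrite /Q subrK scalerA -rmorphM/= mulfV// scale1r.
  have pQ x : p (Q x) <= e * rnorm x.
    rewrite (le_trans (rsn_le _ _))//.
    rewrite (@le_trans _ _ (opnorm Q * rnorm x))//; last first.
      by rewrite ler_wpM2r ?rnorm_ge0// ltW// (le_lt_trans _ Qe)// ler_norm.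
    have [m1 _ m1P] := bop_rbounded (G (t + h)).
    have [m2 _ m2P] := bop_rbounded (G t).
    have [m3 _ m3P] := bop_rbounded G'.
    apply: (@le_opseminorm R U V (@norm_seminorm R V) Q (`|h^-1| * (m1 + m2) + m3)).
      move=> a y; rewrite /Q [RHS]scalerBr; congr (_ - _); last exact: linearZZ.
      rewrite [RHS]scalerA mulrC -scalerA; congr (_ *: _).
      by rewrite scalerBr; congr (_ - _); exact: linearZZ.
    move=> y; rewrite /Q (le_trans (ler_rnormD _ _))// rnormN rnormZr mulrDl lerD//.
    rewrite -mulrA ler_wpM2l// (le_trans (ler_rnormD _ _))// rnormN mulrDl.
    by rewrite lerD.
  apply: opseminorm_le => [|x]; first by rewrite mulr_ge0.
  rewrite QE (le_trans (rsnZr _ _ _))// [_ * `|h|]mulrC -mulrA ler_wpM2l//.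
  by rewrite (le_trans (rsnD _ _ _))// addrC mulrDl lerD// le_opseminorm_bop.
exists d => // u v tu ut tv vt.
rewrite (le_trans (opseminorm_diff_triangle p (G u) (G t) (G v)))//.
have -> : (opseminorm p G' + e) * (v - u) =
  (opseminorm p G' + e) * `|u - t| + (opseminorm p G' + e) * `|v - t|.
  by rewrite ler0_norm ?subr_le0// ger0_norm ?subr_ge0// -mulrDr; congr (_ * _); lra.
rewrite lerD//.
  have := key (u - t); rewrite [t + _]addrC subrK => H.
  rewrite (le_trans _ (H _))//; last first.
    by rewrite ler0_norm ?subr_le0// opprB ltrBlDl -ltrBlDr.
  apply: opseminorm_le => [|x]; first exact: opseminorm_ge0.
  by rewrite -rsnN opprB le_opseminorm_diff.
have := key (v - t); rewrite [t + _]addrC subrK; apply.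
by rewrite ger0_norm ?subr_ge0// ltrBlDl.
Qed.

End seminorm_increments.

(** The inverses of a continuous family of invertible operators are locally
    bounded: if [m] bounds the inverse at [t], then [2 * m] bounds the inverse
    of any operator within [1 / (2 * m)] of it. *)
Lemma op_abs_cont_inverse_near (R : realType) (U V : normedModType R[i])
    (s : R -> 'L(U, V)) t :
  op_abs_cont s -> bop_invertible (s t) ->
  exists2 d : R, 0 < d & exists2 c : R, 0 <= c &
    forall r, `|r - t| < d -> forall x, rnorm x <= c * rnorm (s r x).
Proof.
move=> sac [g [gs _]].
have [m m0 gm] := bop_rbounded g.
(* The radius 1 / (2 * m + 1) makes sense for m = 0 too. *)
have m1 : 0 < 2 * m + 1 by rewrite ltr_wpDl// mulr_ge0.
have [|d d0 dP] := @op_abs_cont_near R U V s t (2 * m + 1)^-1 sac.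
  by rewrite invr_gt0.
exists d => //; exists (2 * m); first by rewrite mulr_ge0.
move=> r /dP rt x.
have := gm (s t x); rewrite gs => xm.
have : rnorm (s t x) <= rnorm (s r x) + (2 * m + 1)^-1 * rnorm x.
  have -> : s t x = s r x - (s r x - s t x) by rewrite subKr.
  rewrite (le_trans (ler_rnormD _ _))// rnormN lerD2l.
  rewrite (le_trans (rnorm_opnorm_diff _ _ _))// ler_wpM2r ?rnorm_ge0//.
  exact: ltW.
move=> /(ler_wpM2l m0) /(le_trans xm); rewrite mulrDr mulrA => H.
have mi : m * (2 * m + 1)^-1 <= 2^-1.
  by rewrite ler_pdivrMr// mulrDr mulrA mulVf ?mul1r ?lerDl.
have := ler_wpM2r (rnorm_ge0 x) mi.
lra.
Qed.

(** * Gronwall's argument in a seminorm *)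

Section seminorm_gronwall.
Context {R : realType} {U U' V : normedModType R[i]}.
Variables (p : @rseminorm R V) (A : 'L(V, V)) (alpha : R).
Hypothesis alpha0 : 0 <= alpha.
Hypothesis pA : forall x, p (A x) <= alpha * p x.
Variables (b : R -> 'L(U', V)) (s1 s2 ga : R -> 'L(U, U')).
Let X t : 'L(U, V) := b t \bo s1 t.
Hypothesis Xac : op_abs_cont X.
Hypothesis s1ac : op_abs_cont s1.
Hypothesis s1inv : forall t, bop_invertible (s1 t).
Hypothesis s2L : op_L1loc s2.
Hypothesis gaL : op_L1loc ga.
Hypothesis ode : {ae lebesgue_measure, forall t,
  exists2 X' : 'L(U, V), op_is_derive X t X' &
    forall e, X' e + A (b t (s2 t e)) + b t (ga t e) = 0}.

(** Writing [b t = X t \o (s1 t)^-1] turns the equation into one that is linear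
    in [X], whose right-hand side is bounded in the seminorm by that of [X]
    because [A] is bounded in the seminorm. *)
Lemma gronwall_derivative_bound t (X' : 'L(U, V)) c : 0 <= c ->
  (forall x, rnorm x <= c * rnorm (s1 t x)) ->
  (forall e, X' e + A (b t (s2 t e)) + b t (ga t e) = 0) ->
  opseminorm p X' <= c * (alpha * opnorm (s2 t) + opnorm (ga t)) * opseminorm p (X t).
Proof.
move=> c0 s1c X'E.
have pb w : p (b t w) <= opseminorm p (X t) * (c * rnorm w).
  have [g [_ gK]] := s1inv t; rewrite -[w in X in X <= _]gK.
  rewrite (le_trans (le_opseminorm_bop p (X t) (g w)))// ler_wpM2l ?opseminorm_ge0//.
  by rewrite -{2}[w]gK.
apply: opseminorm_le => [|x].
  by rewrite !mulr_ge0 ?addr_ge0 ?mulr_ge0 ?opseminorm_ge0 ?opnorm_ge0.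
have -> : X' x = - (A (b t (s2 t x)) + b t (ga t x)).
  by apply/eqP; rewrite -addr_eq0 addrA X'E.
rewrite rsnN (le_trans (rsnD _ _ _))//.
have H1 : p (A (b t (s2 t x))) <=
    alpha * (opseminorm p (X t) * (c * (opnorm (s2 t) * rnorm x))).
  rewrite (le_trans (pA _))// ler_wpM2l// (le_trans (pb _))//.
  by rewrite !ler_wpM2l ?opseminorm_ge0// rnorm_opnorm.
have H2 : p (b t (ga t x)) <= opseminorm p (X t) * (c * (opnorm (ga t) * rnorm x)).
  by rewrite (le_trans (pb _))// !ler_wpM2l ?opseminorm_ge0// rnorm_opnorm.
apply: (le_trans (lerD H1 H2)); rewrite le_eqVlt; apply/orP; left; apply/eqP; ring.
Qed.

(** Let [M] be the supremum of the seminorm of [X] on a small interval around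
    [t1]. The increments of [X] are bounded by [M] times those of a primitive
    of the coefficient in [gronwall_derivative_bound]. This primitive is
    continuous, so it varies by at most [1 / 2] on a small enough interval; as
    [X t1] vanishes for [p], this gives [M <= M / 2]. *)
Lemma gronwall_local t1 : (forall e, p (X t1 e) = 0) ->
  exists2 d : R, 0 < d & forall t, `|t - t1| < d -> forall e, p (X t e) = 0.
Proof.
move=> Xt1.
have [d1 d10 [c c0 s1c]] := op_abs_cont_inverse_near s1ac (s1inv t1).
have [d2 d20 X1] := op_abs_cont_near t1 Xac ltr01.
have [k2 [k20 ik2 k2E]] := L1loc_opnorm_version s2L.
have [kg [kg0 ikg kgE]] := L1loc_opnorm_version gaL.
pose k t := c * (alpha * k2 t + kg t).
have k0 t : 0 <= k t by rewrite mulr_ge0// addr_ge0// mulr_ge0.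
have ik : lebesgue_measure.-integrable `[t1 - 1, t1 + 1] (EFin \o k).
  rewrite (_ : EFin \o k =
    (fun t => c%:E * (alpha%:E * (k2 t)%:E + (kg t)%:E)))%E; last first.
    by apply/funext => t; rewrite /= -!EFinM.
  apply: integrableZl => //; apply: integrableD => //.
  exact: integrableZl.
have [|g [gmono gcont gder]] := primitive_ae_derivative _ k0 ik; first by lra.
have [d3 d30 g12] : exists2 d : R, 0 < d &
    forall t, `|t - t1| < d -> `|g t - g t1| < 2^-1.
  have h0 : 0 < 2^-1 :> R by rewrite invr_gt0.
  have /gcont/cvgrPdist_lt/(_ _ h0) : t1 \in `]t1 - 1, t1 + 1[ by rewrite in_itv/=; lra.
  move=> /nbhs_ballP[d /= d0 dP]; exists d => // t td.
  by rewrite distrC; apply: dP; rewrite /ball/= distrC.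
(* Half the smallest radius, so that the closed interval of radius r fits. *)
pose r := Num.min (Num.min d1 d2) (Num.min d3 1) / 2.
have [r0 [rd1 [rd2 [rd3 r1]]]] : 0 < r /\ r < d1 /\ r < d2 /\ r < d3 /\ r < 1.
  pose m := Num.min (Num.min d1 d2) (Num.min d3 1).
  have m0 : 0 < m by rewrite !lt_min d10 d20 d30/=.
  have : r < m by rewrite /r -/m; lra.
  rewrite !lt_min => /andP[/andP[-> ->] /andP[-> ->]]; split=> //.
  by rewrite /r -/m; lra.
pose S := [set opseminorm p (X t) | t in [set t | `|t - t1| <= r]].
have S_le t : `|t - t1| <= r -> opseminorm p (X t) <= 1.
  move=> tr; rewrite (le_trans (@opseminorm_le_diff R U V p (X t) (X t1) Xt1))//.
  rewrite (le_trans (opseminorm_diff_le_opnorm _ _ _))// ltW// X1//.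
  exact: le_lt_trans rd2.
have S1 : S (opseminorm p (X t1)) by exists t1 => //=; rewrite subrr normr0 ltW.
have supS : has_sup S.
  by split; [exists (opseminorm p (X t1))|exists 1 => _ [t /= tr <-]; exact: S_le].
have M1 : sup S <= 1.
  by apply: ge_sup; [exists (opseminorm p (X t1))|move=> _ [t /= tr <-]; exact: S_le].
have M0 : 0 <= sup S.
  by rewrite (le_trans (opseminorm_ge0 p (X t1)))// ub_le_sup//; exact: supS.2.
have SM t : `|t - t1| <= r -> opseminorm p (X t) <= sup S.
  by move=> tr; apply: ub_le_sup; [exact: supS.2|exists t].
have incr u v : t1 - r <= u -> u <= v -> v <= t1 + r ->
    opseminorm p (fun x => X v x - X u x) <= sup S * (g v - g u).
  move=> ru uv vr.
  set Z := ~` [set t | [/\ k2 t = opnorm (s2 t), kg t = opnorm (ga t),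
    exists2 X' : 'L(U, V), op_is_derive X t X' &
      forall e, X' e + A (b t (s2 t e)) + b t (ga t e) = 0 &
    t1 - 1 < t < t1 + 1 -> forall e, 0 < e -> exists2 d : R, 0 < d &
      forall u v, t - d < u -> u <= t -> t <= v -> v < t + d ->
        (k t - e) * (v - u) <= g v - g u]].
  have Z0 : lebesgue_measure.-negligible Z.
    have aeF := ae_filter_ringOfSetsType (@lebesgue_measure R).
    have := @filterI _ _ aeF _ _ (@filterI _ _ aeF _ _ k2E kgE)
      (@filterI _ _ aeF _ _ ode gder).
    by apply: (@filterS _ _ aeF) => t [[? ?] [? ?]].
  rewrite mulrBr.
  apply: (@abs_cont_increment_le R u v
    (fun u v => opseminorm p (fun x => X v x - X u x)) (fun t => sup S * g t) Z) => //.
  - by move=> x y z _ _; exact: opseminorm_diff_triangle.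
  - move=> e e0; have [d d0 dP] := Xac u v e0.
    exists d => // n x y xy triv xyd; apply: le_lt_trans (dP n x y xy triv xyd).
    by apply: ler_sum => i _; exact: opseminorm_diff_le_opnorm.
  - move=> x y ux xy yv; rewrite ler_wpM2l// gmono//; lra.
  - move=> t /andP[ut tv] /contrapT[k2t kgt [X' dX' X'E] gt] e e0.
    have tr : `|t - t1| <= r by rewrite ler_norml; lra.
    have e2 : 0 < e / 2 by rewrite divr_gt0.
    have tI : t1 - 1 < t < t1 + 1 by lra.
    have [d dd0 dP] := gt tI _ e2.
    have [d' d'0 d'P] := op_is_derive_straddle p dX' e2.
    exists (Num.min d d') => [|x y _ tx xt ty yt _]; first by rewrite lt_min dd0.
    have [dx dy d'x d'y] : [/\ t - d < x, y < t + d, t - d' < x & y < t + d'].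
      have md : Num.min d d' <= d by rewrite ge_min lexx.
      have md' : Num.min d d' <= d' by rewrite ge_min lexx orbT.
      by split; lra.
    have xy : x <= y by exact: le_trans ty.
    rewrite (le_trans (d'P _ _ d'x xt ty d'y))//.
    have kM : opseminorm p X' <= sup S * k t.
      rewrite (le_trans (gronwall_derivative_bound c0 _ X'E))//.
        by apply: s1c; exact: le_lt_trans rd1.
      by rewrite /k k2t kgt mulrC ler_wpM2r ?SM// -?k2t -?kgt; exact: (k0 t).
    have := ler_wpM2l M0 (dP x y dx xt ty dy).
    have yx : 0 <= y - x by rewrite subr_ge0.
    have := ler_wpM2r yx kM.
    have := ler_wpM2r (mulr_ge0 (ltW e0) yx) M1.
    nra.
have half t : `|t - t1| <= r -> opseminorm p (X t) <= sup S * 2^-1.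
  move=> tr; rewrite (le_trans (@opseminorm_le_diff R U V p (X t) (X t1) Xt1))//.
  have := g12 t (le_lt_trans tr rd3); rewrite ltr_norml => /andP[g1 g2].
  move: tr; rewrite ler_norml => /andP[rt tr].
  have [tt1|tt1] := leP t t1.
    rewrite (@le_trans _ _ (opseminorm p (fun x => X t1 x - X t x)))//.
      apply: opseminorm_le => [|x]; first exact: opseminorm_ge0.
      by rewrite -rsnN opprB le_opseminorm_diff.
    rewrite (le_trans (incr _ _ _ tt1 _))//; [lra|lra|].
    by rewrite ler_wpM2l//; lra.
  rewrite (le_trans (incr _ _ _ (ltW tt1) _))//; [lra|lra|].
  by rewrite ler_wpM2l//; lra.
have supS0 : sup S <= 0.
  have : sup S <= sup S * 2^-1.
    by apply: ge_sup; [exists (opseminorm p (X t1))|move=> _ [t /= tr <-]; exact: half].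
  lra.
exists r => // t /ltW tr e; apply/eqP; rewrite eq_le rsn_ge0 andbT.
rewrite (le_trans (le_opseminorm_bop p (X t) e))//.
by rewrite mulr_le0_ge0 ?rnorm_ge0// (le_trans (SM t tr)).
Qed.

(** The set of times at which [X] vanishes for [p] is open by the local result,
    closed by continuity of [X], and the line is connected. *)
Lemma gronwall_global t0 : (forall e, p (X t0 e) = 0) ->
  forall t e, p (X t e) = 0.
Proof.
move=> X0; pose S := [set t | forall e, p (X t e) = 0].
suff ST : S = setT by move=> t; have : S t by rewrite ST.
have cT : connected [set: R] by apply/connected_intervalP.
apply: cT.
- by exists t0.
- exists S; last by rewrite setTI.
  rewrite openE => t /gronwall_local[d d0 dP].
  by apply/nbhs_ballP; exists d => // s; rewrite /ball/= distrC; exact: dP.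
- exists S; last by rewrite setTI.
  move=> t clt e; apply/eqP; rewrite eq_le rsn_ge0 andbT.
  apply/ler_addgt0Pl => eps eps0; rewrite addr0.
  have n1 : 0 < rnorm e + 1 by rewrite ltr_wpDl// rnorm_ge0.
  have [d d0 dP] := op_abs_cont_near t Xac (divr_gt0 eps0 n1).
  have [s [Ss ts]] := clt _ (nbhsx_ballx t d d0).
  rewrite -[X t e](subrK (X s e)) (le_trans (rsnD _ _ _))// Ss addr0.
  rewrite (le_trans (rsn_le _ _))// (le_trans (rnorm_opnorm_diff _ _ _))//.
  have st : `|s - t| < d by rewrite distrC.
  have := ltW (dP s st); rewrite opnorm_diffC => H.
  rewrite (le_trans (ler_wpM2r (rnorm_ge0 _) H))//.
  by rewrite mulrAC ler_pdivrMr// ler_wpM2l ?lerDl// ltW.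
Qed.

End seminorm_gronwall.

(** * Distance to a linear span *)

Section linear_span.
Context {K : pzRingType} {V : lmodType K}.
Implicit Types (S : set V) (x y : V).

Lemma lin_span_sub S : S `<=` lin_span S.
Proof.
move=> x Sx; exists 1%N, (fun=> 1), (fun=> x); split=> //.
by rewrite big_ord1 scale1r.
Qed.

Lemma lin_span0 S : lin_span S 0.
Proof. by exists 0%N, (fun=> 0), (fun=> 0); split=> [[]//|]; rewrite big_ord0. Qed.

Lemma lin_spanD S x y : lin_span S x -> lin_span S y -> lin_span S (x + y).
Proof.
move=> [n [a [v [Sv ->]]]] [m [b [w [Sw ->]]]].
exists (n + m)%N,
  (fun i : 'I_(n + m) => match fintype.split i with inl i => a i | inr i => b i end),
  (fun i : 'I_(n + m) => match fintype.split i with inl i => v i | inr i => w i end).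
split; first by move=> i; case: fintype.split.
rewrite big_split_ord/=; congr (_ + _); apply: eq_bigr => i _.
  by rewrite (unsplitK (inl i)).
by rewrite (unsplitK (inr i)).
Qed.

Lemma lin_spanZ S c x : lin_span S x -> lin_span S (c *: x).
Proof.
move=> [n [a [v [Sv ->]]]]; exists n, (fun i => c * a i), v; split=> //.
by rewrite scaler_sumr; apply: eq_bigr => i _; rewrite scalerA.
Qed.

Lemma lin_span_ind S (P : V -> Prop) : P 0 ->
  (forall x y, P x -> P y -> P (x + y)) -> (forall c x, P x -> P (c *: x)) ->
  S `<=` P -> lin_span S `<=` P.
Proof.
move=> P0 PD PZ SP x [n [a [v [Sv ->]]]].
by apply: big_ind => // i _; exact/PZ/SP.
Qed.

End linear_span.

Section distance_seminorm.
Context {R : realType} {V : normedModType R[i]}.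
Variable S : set V.

Definition span_dist (x : V) : R := inf [set rnorm (x - k) | k in lin_span S].

Let nonempty x : [set rnorm (x - k) | k in lin_span S] !=set0.
Proof. by exists (rnorm (x - 0)), 0 => //; exact: lin_span0. Qed.

Let has_inf_dist x : has_inf [set rnorm (x - k) | k in lin_span S].
Proof. by split=> //; exists 0 => _ [k _ <-]; exact: rnorm_ge0. Qed.

Lemma span_dist_le x k : lin_span S k -> span_dist x <= rnorm (x - k).
Proof. by move=> Sk; apply: ge_inf; [exact: (has_inf_dist x).2|exists k]. Qed.

Lemma span_dist_lt x e : span_dist x < e ->
  exists2 k, lin_span S k & rnorm (x - k) < e.
Proof.
by move=> /(inf_lt (nonempty x))[_ [k Sk <-] ke]; exists k.
Qed.

Lemma span_dist_ge0 x : 0 <= span_dist x.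
Proof. by apply: lb_le_inf => // _ [k _ <-]; exact: rnorm_ge0. Qed.

Lemma span_dist_le_rnorm x : span_dist x <= rnorm x.
Proof. by rewrite -{2}[x]subr0 span_dist_le//; exact: lin_span0. Qed.

Lemma span_distD x y : span_dist (x + y) <= span_dist x + span_dist y.
Proof.
apply/ler_addgt0Pl => e e0.
have [|k Sk xk] := @span_dist_lt x (span_dist x + e / 2).
  by rewrite ltrDl divr_gt0.
have [|l Sl yl] := @span_dist_lt y (span_dist y + e / 2).
  by rewrite ltrDl divr_gt0.
have := span_dist_le (x + y) (lin_spanD Sk Sl).
rewrite opprD addrACA => /le_trans/(_ (ler_rnormD _ _)); lra.
Qed.

(** The distance of [f x] to the span is estimated with the images [f k] of the
    points [k] of the span. *)
Lemma span_dist_map (f : V -> V) (m : R) : 0 <= m ->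
  (forall k, lin_span S k -> lin_span S (f k)) ->
  (forall x y, rnorm (f x - f y) <= m * rnorm (x - y)) ->
  forall x, span_dist (f x) <= m * span_dist x.
Proof.
move=> m0 fS fm x; apply/ler_addgt0Pl => e e0.
have m1 : 0 < m + 1 by rewrite ltr_wpDl.
have [|k Sk xk] := @span_dist_lt x (span_dist x + e / (m + 1)).
  by rewrite ltrDl divr_gt0.
rewrite (le_trans (span_dist_le (f x) (fS _ Sk)))// (le_trans (fm _ _))//.
rewrite (le_trans (ler_wpM2l m0 (ltW xk)))// mulrDr addrC lerD2r.
by rewrite mulrCA ger_pMr// ler_pdivrMr// mul1r lerDl.
Qed.

Lemma span_distZ (a : R[i]) x :
  span_dist (a *: x) <= rnorm (a : R[i]^o) * span_dist x.
Proof.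
apply: (@span_dist_map ( *:%R a)); first exact: rnorm_ge0.
  by move=> k; exact: lin_spanZ.
by move=> y z; rewrite -scalerBr rnormZ.
Qed.

Definition span_dist_seminorm : @rseminorm R V :=
  RSeminorm span_dist_ge0 span_dist_le_rnorm span_distD span_distZ.

Lemma span_dist_eq0 x : lin_span S x -> span_dist x = 0.
Proof.
move=> Sx; apply/eqP; rewrite eq_le span_dist_ge0 andbT.
by rewrite (le_trans (span_dist_le x Sx))// subrr rnorm0.
Qed.

(** A bounded operator leaving a subspace invariant acts on the quotient. *)
Lemma span_dist_bop (f : 'L(V, V)) : S `<=` f @^-1` (lin_span S) ->
  exists2 m : R, 0 <= m & forall x, span_dist (f x) <= m * span_dist x.
Proof.
move=> fS; have [m m0 fm] := bop_rbounded f; exists m => //.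
apply: span_dist_map => // [|x y]; last by rewrite -linearB.
apply: lin_span_ind fS; rewrite /preimage/=.
- by rewrite linear0; exact: lin_span0.
- by move=> x y fx fy; rewrite linearD; exact: lin_spanD.
- by move=> c x fx; rewrite linearZ; exact: lin_spanZ.
Qed.

End distance_seminorm.

Lemma dense_rnormP (R : realType) (V : normedModType R[i]) (S : set V) :
  dense S <-> forall x (e : R), 0 < e -> exists2 k, S k & rnorm (x - k) < e.
Proof.
split=> [dS x e e0|H O [x Ox] oO].
  have e0' : 0 < e%:C%C :> R[i] by rewrite ltcR.
  have [||k [/= xk Sk]] := dS (ball x e%:C%C).
  - by exists x; exact: ballxx.
  - exact: ball_open.
  by exists k => //; move: xk; rewrite -ball_normE/= normr_rnorm ltcR.
have /nbhs_ballP[e /= e0 eO] := open_nbhs_nbhs (conj oO Ox).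
have eE : e = (complex.Re e)%:C%C.
  by move: e0; rewrite ltcE/=; case: (e) => a b /= /andP[/eqP-> _].
have [|k Sk xk] := H x (complex.Re e); first by rewrite -ltcR -eE.
exists k; split=> //; apply: eO.
by rewrite -ball_normE/= normr_rnorm eE ltcR.
Qed.

(** The line is not a null set. *)
Lemma ae_lebesgue_ex (R : realType) (P : R -> Prop) :
  {ae lebesgue_measure, forall t, P t} -> exists t, P t.
Proof.
move=> [Z [mZ Z0 PZ]]; apply: contrapT => nP.
have ZT : Z = setT by apply/seteqP; split=> // t _; apply: PZ => Pt; apply: nP; exists t.
have : (lebesgue_measure (`[0%R, 1%R]%classic : set R) <= lebesgue_measure Z)%E.
  by rewrite le_measure// ?inE// ZT.
by rewrite [X in (_ <= X)%E -> _]Z0 lebesgue_measure_itv/= lte_fin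
  ltr01 sube0 lee_fin ler10.
Qed.

Lemma op_abs_cont_comp (R : realType) (U V W : normedModType R[i])
    (f : 'L(V, W)) (G : R -> 'L(U, V)) (H : R -> 'L(U, W)) :
  (forall s x, H s x = f (G s x)) -> op_abs_cont G -> op_abs_cont H.
Proof.
move=> HE Gac a b e e0; have [m m0 fm] := bop_rbounded f.
have m1 : 0 < m + 1 by rewrite ltr_wpDl.
have [d d0 dP] := Gac a b _ (divr_gt0 e0 m1).
exists d => // n u v uv triv uvd.
have := dP n u v uv triv uvd; rewrite ltr_pdivlMr// mulr_suml; apply: le_lt_trans.
apply: ler_sum => i _; apply: opnorm_le => [|x].
  by rewrite mulr_ge0// ?opnorm_ge0// ltW.
rewrite !HE -linearB (le_trans (fm _))// [_ * (m + 1)]mulrC -mulrA ler_pM//.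
- exact: rnorm_ge0.
- by rewrite lerDl.
- exact: rnorm_opnorm_diff.
Qed.

(** * Controllability of vessels *)

Section vessel.
Context {R : realType} (V : vessel R).

Lemma vF_iter t s j x :
  vF V t s (iter j (vA1 V s) x) = iter j (vA1 V t) (vF V t s x).
Proof. by elim: j => //= j IH; rewrite lax IH. Qed.

(** The reachable directions never leave the closure of the local controllable
    space at [t0]. By the Lax equation [vF V t0 s] conjugates [vA1 V s] to
    [vA1 V t0], which preserves the local space, so only the images of
    [vF V t0 s \bo vBt V s] matter; composed with [sigma1 V s] they solve the
    input vessel condition and lie in the local space at [s = t0], so the
    uniqueness argument applies to the distance to that space. *)
Lemma controllable_space_dist0 t0 (x : vH V t0) : controllable_space V t0 x ->
  span_dist (\bigcup_j range (fun e => iter j (vA1 V t0) (vBt V t0 e))) x = 0.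
Proof.
set S := \bigcup_j _; pose p := span_dist_seminorm S.
have [|m m0 pA] := @span_dist_bop _ _ S (vA1 V t0).
  by move=> _ [j _ [w _ <-]]; apply: lin_span_sub; exists j.+1 => //; exists w.
pose b s : 'L(_, vH V t0) := vF V t0 s \bo vBt V s.
have Xac : op_abs_cont (fun s => b s \bo sigma1 V s).
  (* Absolute continuity is given for almost every base point; the propagator
     carries it from one of them to t0. *)
  have [t Ft] := ae_lebesgue_ex (FBsigma1_ac V).
  apply: (@op_abs_cont_comp _ _ _ _ (vF V t0 t) _ _ _ Ft) => s e /=.
  by rewrite F_comp.
have pX s e : p (b s (sigma1 V s e)) = 0.
  apply: (@gronwall_global R _ _ _ p (vA1 V t0) m m0 pA b (sigma1 V) (sigma2 V)
    (gamma V) Xac (sigma1_ac V) (sigma1_invertible V) (sigma2_L1loc V)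
    (gamma_L1loc V) _ t0).
    have aeF := ae_filter_ringOfSetsType (@lebesgue_measure R).
    apply: (@filterS _ _ aeF _ _ _ (input_condition V t0)) => t [X' dX X'E].
    by exists X' => // u; rewrite -[RHS](X'E u) /= lax.
  move=> u /=; rewrite F_id; apply: span_dist_eq0; apply: lin_span_sub.
  by exists 0%N => //; exists (sigma1 V t0 u).
have p0 y : 0 <= p y by exact: rsn_ge0.
apply: (@lin_span_ind _ _ _ (fun y => p y = 0)) => [|y z py pz|c y py|].
- by apply: span_dist_eq0; exact: lin_span0.
- by apply/eqP; rewrite eq_le p0 andbT (le_trans (rsnD p _ _))// py pz addr0.
- by apply/eqP; rewrite eq_le p0 andbT (le_trans (rsnZ p _ _))// py mulr0.
- move=> _ [s _ [j _ [w _ <-]]]; rewrite vF_iter.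
  have [g [_ gK]] := sigma1_invertible V s.
  elim: j => [|j IH] /=; first by rewrite -[w]gK; exact: pX.
  apply/eqP; rewrite eq_le p0 andbT (le_trans (pA _))//.
  by rewrite (_ : span_dist S _ = 0) ?mulr0//; exact: IH.
Qed.

End vessel.

Theorem theorem3p1 (R : realType) (V : vessel R) (t0 : R) :
  locally_approximately_controllable V t0 <->
  (forall t : R, approximately_controllable V t).
Proof.
rewrite /locally_approximately_controllable /approximately_controllable.
(* The propagator from t0 to t is an isomorphism and maps the local space at t0
   into the controllable space at t. Conversely, controllability at t0 suffices
   because the controllable space there lies in the closure of the local one. *)
split=> [/dense_rnormP loc t|/(_ t0)/dense_rnormP ctrl]; apply/dense_rnormP => x e e0.
  have [m m0 Fm] := bop_rbounded (vF V t t0).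
  have m1 : 0 < m + 1 by rewrite ltr_wpDl.
  have [k kS xk] := loc (vF V t0 t x) _ (divr_gt0 e0 m1).
  exists (vF V t t0 k).
    apply: (@lin_span_ind _ _ _ (fun k => controllable_space V t (vF V t t0 k))) kS.
    - by rewrite linear0; exact: lin_span0.
    - by move=> y z; rewrite linearD; exact: lin_spanD.
    - by move=> c y; rewrite linearZ; exact: lin_spanZ.
    - move=> _ [j _ [u _ <-]]; apply: lin_span_sub.
      by exists t0 => //; exists j => //; exists u.
  have -> : x - vF V t t0 k = vF V t t0 (vF V t0 t x - k).
    by rewrite linearB F_comp F_id.
  rewrite (le_lt_trans (Fm _))//.
  rewrite (le_lt_trans (ler_wpM2l m0 (ltW xk)))//.
  by rewrite mulrCA gtr_pMr// ltr_pdivrMr// mul1r ltrDl.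
have e2 : 0 < e / 2 by rewrite divr_gt0.
have [y Sy xy] := ctrl x _ e2.
have := e2; rewrite -{1}(controllable_space_dist0 Sy) => /span_dist_lt[k Sk yk].
exists k => //; rewrite -[x](subrK y) -addrA (le_lt_trans (ler_rnormD _ _))//.
by rewrite [e]splitr ltrD.
Qed.
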